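(* Let $k\ge1$, $p_1,\dots,p_k\ge 1$, $s_i\ge 0$, $a_{ij}\ge 1$ be integers, and let $r\ge 1$. Suppose $A(n)$ and $B(n)$ are well-defined sequences both satisfying, for all $n>r$, $$A(n)=\sum_{i=1}^k A\Big(n-s_i-\sum_{j=1}^{p_i}A(n-a_{ij})\Big),\qquad B(n)=\sum_{i=1}^k B\Big(n-s_i-\sum_{j=1}^{p_i}B(n-a_{ij})\Big),$$ with initial conditions $A(1),\dots,A(r)$ and $B(1),\dots,B(r)$ respectively. Define $C$ by $C(1),\dots,C(2r)=2A(1),2B(1),2A(2),2B(2),\dots,2A(r),2B(r)$ and, for $n>r$, $C(2n-1)=2A(n)$ and $C(2n)=2B(n)$. Then $C$ is a solution of the ''doubled'' recursion $$C(n)=\sum_{i=1}^k C\Big(n-2s_i-\sum_{j=1}^{p_i}C(n-2a_{ij})\Big)\qquad (n>2r)$$ with initial conditions $C(1),\dots,C(2r)$. *)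

(* Defs.v *)
From mathcomp Require Import all_boot all_order all_algebra.

Set Implicit Arguments.
Unset Strict Implicit.
Unset Printing Implicit Defensive.

Import Order.TTheory GRing.Theory Num.Theory.
Local Open Scope ring_scope.

(* Sequences are indexed by the positive integers.  As the indices occurring
   in a nested recursion are themselves integer expressions, a sequence is
   represented by a function int -> int; [well_defined] below guarantees that
   its values at indices <= 0 are never consulted. *)

Definition nested_index (k : nat) (p : 'I_k -> nat) (s : 'I_k -> nat)
    (a : forall i : 'I_k, 'I_(p i) -> nat) (A : int -> int) (n : int)
    (i : 'I_k) : int :=
  n - (s i)%:Z - \sum_(j < p i) A (n - (a i j)%:Z).

(* For every n > r, each term A(m) on the right-hand side of the recursion
   for A(n) is an already computed one, i.e. 1 <= m < n. *)
Definition well_defined (k : nat) (p : 'I_k -> nat) (s : 'I_k -> nat)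
    (a : forall i : 'I_k, 'I_(p i) -> nat) (r : nat) (A : int -> int) : Prop :=
  forall n : int, r%:Z < n ->
  forall i : 'I_k,
    (forall j : 'I_(p i), 1 <= n - (a i j)%:Z < n) /\
    1 <= nested_index s a A n i < n.

(* A(1), ..., A(r) are left unconstrained: they are the initial conditions. *)
Definition is_solution (k : nat) (p : 'I_k -> nat) (s : 'I_k -> nat)
    (a : forall i : 'I_k, 'I_(p i) -> nat) (r : nat) (A : int -> int) : Prop :=
  well_defined s a r A /\
  forall n : int, r%:Z < n -> A n = \sum_(i < k) A (nested_index s a A n i).

(* Main.v *)
(* The doubled recursion maps the residue class of 2n - d (d = 0 or 1) into
   itself: subtracting even shifts and a sum of even values preserves parity.
   Along that class, C(2n - d) = 2 X(n) turns it into twice the recursion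
   for X, so the odd and even subsequences evolve independently. *)

Require Import Defs.
From mathcomp Require Import all_boot all_order all_algebra.
From mathcomp Require Import zify ring.

Set Implicit Arguments.
Unset Strict Implicit.
Unset Printing Implicit Defensive.

Import Order.TTheory GRing.Theory Num.Theory.
Local Open Scope ring_scope.

(** An inner argument regroups as [2 * (n - a i j) - d], in the same class as [2 * n - d], and
    [a_lt] keeps it in the range where [C] doubles [X]. *)
Lemma nested_index_doubled (k : nat) (p : 'I_k -> nat) (s : 'I_k -> nat)
    (a : forall i : 'I_k, 'I_(p i) -> nat) (X C : int -> int) (d n : int)
    (i : 'I_k) :
  (forall m : int, 1 <= m -> C (2 * m - d) = 2 * X m) ->
  (forall j : 'I_(p i), 1 <= n - (a i j)%:Z) ->
  nested_index (fun i => (2 * s i)%N) (fun i j => (2 * a i j)%N) C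
    (2 * n - d) i = 2 * nested_index s a X n i - d.
Proof.
move=> CX a_lt; rewrite /nested_index.
have -> : \sum_(j < p i) C (2 * n - d - (2 * a i j)%N%:Z) =
          2 * \sum_(j < p i) X (n - (a i j)%:Z).
  rewrite mulr_sumr; apply: eq_bigr => j _.
  by rewrite -CX //; congr C; lia.
by rewrite PoszM; ring.
Qed.

(** Keeping [d] abstract lets one argument serve both parities. The bound [d <= 1] is what turns
    [1 <= m < n] into [1 <= 2 * m - d < 2 * n - d]. *)
Lemma doubled_recursion_at (k : nat) (p : 'I_k -> nat) (s : 'I_k -> nat)
    (a : forall i : 'I_k, 'I_(p i) -> nat) (r : nat) (X C : int -> int)
    (d n : int) :
  d <= 1 -> is_solution s a r X ->
  (forall m : int, 1 <= m -> C (2 * m - d) = 2 * X m) ->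
  r%:Z < n ->
  let s2 := fun i => (2 * s i)%N in
  let a2 := fun (i : 'I_k) (j : 'I_(p i)) => (2 * a i j)%N in
  let N := 2 * n - d in
  (forall i : 'I_k,
    (forall j : 'I_(p i), 1 <= N - (a2 i j)%:Z < N) /\
    1 <= nested_index s2 a2 C N i < N) /\
  C N = \sum_(i < k) C (nested_index s2 a2 C N i).
Proof.
move=> d_le1 [wfX recX] CX r_lt_n s2 a2 N.
have idxE i : nested_index s2 a2 C N i = 2 * nested_index s a X n i - d.
  apply: nested_index_doubled => // j.
  by have [/(_ j) /andP[]] := wfX n r_lt_n i.
split=> [i|].
  have [shiftP /andP[idx_ge1 idx_lt]] := wfX n r_lt_n i.
  split=> [j|]; last by rewrite idxE /N; lia.
  by have := shiftP j; rewrite /a2 /N; lia.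
rewrite /N CX; last by lia.
rewrite recX // mulr_sumr; apply: eq_bigr => i _.
(* Positivity of the index for [X] allows [CX] at the outer term. *)
have [_ /andP[idx_ge1 _]] := wfX n r_lt_n i.
by rewrite idxE CX.
Qed.

Theorem theorem2p3 (k : nat) (p : 'I_k -> nat) (s : 'I_k -> nat)
    (a : forall i : 'I_k, 'I_(p i) -> nat) (r : nat) (A B C : int -> int)
    (hk : (1 <= k)%N)
    (hp : forall i : 'I_k, (1 <= p i)%N)
    (ha : forall (i : 'I_k) (j : 'I_(p i)), (1 <= a i j)%N)
    (hr : (1 <= r)%N)
    (hA : is_solution s a r A)
    (hB : is_solution s a r B)
    (hC_init : forall n : int, 1 <= n <= r%:Z ->
       C (2 * n - 1) = 2 * A n /\ C (2 * n) = 2 * B n)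
    (hC : forall n : int, r%:Z < n ->
       C (2 * n - 1) = 2 * A n /\ C (2 * n) = 2 * B n) :
  is_solution (fun i : 'I_k => (2 * s i)%N)
    (fun (i : 'I_k) (j : 'I_(p i)) => (2 * a i j)%N) (2 * r)%N C.
Proof.
have CAB (n : int) : 1 <= n -> C (2 * n - 1) = 2 * A n /\ C (2 * n) = 2 * B n.
  move=> n_ge1; case: (leP n r%:Z) => [n_le_r|]; last exact: hC.
  by apply: hC_init; rewrite n_ge1.
have CA (n : int) : 1 <= n -> C (2 * n - 1) = 2 * A n by case/CAB.
(* The [- 0] matches the shape [2 * m - d] at [d = 0]. *)
have CB (n : int) : 1 <= n -> C (2 * n - 0) = 2 * B n.
  by rewrite subr0 => /CAB[].
have parity (N : int) : (2 * r)%N%:Z < N ->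
    exists2 n : int, r%:Z < n & N = 2 * n - 1 \/ N = 2 * n - 0.
  (* The witness is [N / 2] rounded up; [N >= 2 * r + 1] makes it at least [r + 1]. *)
  move=> N_gt; exists ((N + 1) %/ 2)%Z; first by lia.
  by case: (boolP ((N %% 2)%Z == 0)) => ?; [right | left]; lia.
(* Well-definedness, then the recursion, each for odd [N] (through [A]) and even [N] (through
   [B]). *)
split=> N /parity[n r_lt_n [] ->].
- by have [] := doubled_recursion_at (lexx 1) hA CA r_lt_n.
- by have [] := doubled_recursion_at ler01 hB CB r_lt_n.
- by have [] := doubled_recursion_at (lexx 1) hA CA r_lt_n.
- by have [] := doubled_recursion_at ler01 hB CB r_lt_n.
Qed.
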